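(* Let $G$ be a finite group, let $G=AB$ be the product of the subgroups $A$ and $B$, and suppose that $G=AB$ is a Baer factorisation. Let $p$ be a prime and let $P$ be a Sylow $p$-subgroup of $G$. Then: (1) If $P$ is not abelian, then $|G:C_G(P)|$ is a $\{p,q\}$-number, for a prime $q$ (possibly $p=q$). (2) If $P$ is abelian, then $|G:C_G(P)|$ is a $\{q,r\}$-number, for some primes $q$ and $r$, both distinct from $p$ (possibly $q=r$). Further, $G/C_G(O_p(G))$ is $p$-decomposable with abelian $p$-complement, and this $p$-complement has order divisible by at most two primes.
   Context: All groups are finite. For $x\in G$, the index of $x$ in $G$ is $i_G(x)=|G:C_G(x)|$. The number $1$ is regarded as a power of every prime. For a set of primes $\pi$, a $\pi$-number is a positive integer all of whose prime divisors lie in $\pi$. ''$G=AB$ is the product of the subgroups $A$ and $B$'' means that $G=\{ab : a\in A, b\in B\}$. $G=AB$ is a Baer factorisation if $i_G(x)$ is a prime power for every element $x\in A\cup B$ of prime power order. $O_\pi(G)$ is the largest normal $\pi$-subgroup of $G$ and $p'$ is the set of primes different from $p$. A group $H$ is $p$-decomposable if $H=O_p(H)\times O_{p'}(H)$; its $p$-complement is then $O_{p'}(H)$. *)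

(* Defs.v *)
From mathcomp Require Import all_boot all_fingroup all_solvable.

Set Implicit Arguments.
Unset Strict Implicit.
Unset Printing Implicit Defensive.

Local Open Scope group_scope.

(* 1 is a power of every prime: the exponent may be 0. *)
Definition prime_power (n : nat) : Prop :=
  exists p k : nat, prime p /\ n = (p ^ k)%N.

Section Baer.

Variable gT : finGroupType.
Implicit Types (G H A B : {group gT}) (x : gT).

Definition cl_index G x : nat := #|G : 'C_G[x]|.

(* The first conjunct is the set product; A and B are thereby subsets of G. *)
Definition Baer_factorisation G A B : Prop :=
  A * B = G /\
  forall x, x \in A :|: B -> prime_power #[x] -> prime_power (cl_index G x).

Definition p_decomposable (p : nat) H : Prop :=
  'O_p(H) \x 'O_p^'(H) = H.

End Baer.

(* Main.v *)
Require Import Defs.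
From mathcomp Require Import all_boot all_fingroup all_solvable.
From mathcomp Require Import integral_char.

Set Implicit Arguments.
Unset Strict Implicit.
Unset Printing Implicit Defensive.

Local Open Scope group_scope.

(* Write (p, q) for a p-element of q-power index.  If x is (p, q), y is (r, s),
   q <> s and r <> q, then a Sylow r-subgroup of C_G(x) is one of G and
   G = C_G(y) C_G(x), so the normal closure of y centralises x.  In a minimal
   non-soluble G this is impossible for nontrivial x and y; comparing elements
   of A and B for three primes dividing |G| (Burnside's p^a q^b theorem) then
   shows that G is soluble.
   Let Q = G / C_G(O_p(G)).  A prime power order element of A or B either
   centralises O_p(G) or has p-power index, hence Q is generated by elements
   of p-power index, which makes its Hall p'-subgroup normal and central.
   Consequently the elements of q-power index in a p-subgroup T generate a
   subgroup whose centraliser has q-power index: for q = p this follows from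
   the structure of Q, for q <> p from that of G / O_q(G), where the Hall
   q'-subgroup is normal.  So a Sylow subgroup A_p of A has a single prime q
   with |G : C_G(A_p)| a q-power, and likewise for B_p; choosing P = A_p B_p
   gives C_G(P) = C_G(A_p) :&: C_G(B_p), whose index involves at most two
   primes.  The index of C_G(O_p(G)) divides it. *)

(** * Coprime indices, cores and class indices *)

Lemma pHall_index_trans (gT : finGroupType) (pi : nat_pred)
    (G C H : {group gT}) :
  C \subset G -> pi^'.-nat #|G : C| -> pi.-Hall(C) H -> pi.-Hall(G) H.
Proof.
move=> sCG piC /and3P[sHC piH pi'CH]; rewrite /pHall (subset_trans sHC) //= piH.
by rewrite -(Lagrange_index sCG sHC) pnatM piC.
Qed.

(** The index [#|K : C|] divides the [pi]-number [#|K|] and, being the index of [C] in [C * K], also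
    the [pi^']-number [#|G : C|]; hence it is 1. *)
Lemma pgroup_sub_index (gT : finGroupType) (pi : nat_pred)
    (G C K : {group gT}) :
    C \subset G -> K \subset G -> C * K = K * C -> pi.-group K ->
    pi^'.-nat #|G : C| ->
  K \subset C.
Proof.
move=> sCG sKG comCK piK pi'C; rewrite -indexg_eq1; apply/eqP/(pnat_1 (pi := pi)).
  exact: pnat_dvd (dvdn_indexg _ _) piK.
apply: pnat_dvd pi'C; rewrite -(indexMg C K) -(comm_joingE comCK).
by apply: indexSg; rewrite ?joing_subl // join_subG sCG.
Qed.

Lemma pcore_sub_index (gT : finGroupType) (pi : nat_pred) (G C : {group gT}) :
  C \subset G -> pi^'.-nat #|G : C| -> 'O_pi(G) \subset C.
Proof.
move=> sCG; apply: pgroup_sub_index (pcore_pgroup _ _) => //.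
  exact: pcore_sub.
exact/normC/(subset_trans sCG)/normal_norm/pcore_normal.
Qed.

Lemma cent_pcore_index (gT : finGroupType) (pi : nat_pred) (G : {group gT}) x :
  pi^'.-nat (cl_index G x) -> x \in 'C('O_pi(G)).
Proof.
move=> p'x; rewrite -sub_cent1.
exact: subset_trans (pcore_sub_index (subsetIl _ _) p'x) (subsetIr _ _).
Qed.

Lemma cl_index_quotient (gT : finGroupType) (G N : {group gT}) x :
  N <| G -> cl_index (G / N)%G (coset N x) %| cl_index G x.
Proof.
move=> /andP[sNG nNG]; apply: dvdn_trans (index_quotient (H := N) _); last first.
  exact: subset_trans (subsetIl _ _) nNG.
exact/indexgS/quotient_subcent1.
Qed.

Lemma cl_index_pnat_quotient (gT : finGroupType) (pi : nat_pred)
    (G N : {group gT}) x :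
  N <| G -> pi.-nat (cl_index G x) -> pi.-nat (cl_index (G / N)%G (coset N x)).
Proof. by move=> nNG; apply/pnat_dvd/cl_index_quotient. Qed.

Lemma class_gen_normal (gT : finGroupType) (G : {group gT}) x :
  x \in G -> <<x ^: G>> <| G.
Proof.
by move=> Gx; rewrite /normal gen_subG class_subG //= norms_gen ?class_norm.
Qed.

(* If [P] is a Sylow [p]-subgroup containing [x], then [G = 'C_G[x] * P], so
   the whole class of [x] lies in [P]. *)
Lemma Wielandt_pcore (gT : finGroupType) (p : nat) (G : {group gT}) x :
  x \in G -> p.-elt x -> p.-nat (cl_index G x) -> x \in 'O_p(G).
Proof.
move=> Gx px pix.
have sxG: <[x]> \subset G by rewrite cycle_subG.
have [P sylP sxP] := Sylow_superset sxG px.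
have [sPG pP p'P] := and3P sylP.
have defG : 'C_G[x] * P = G.
  apply: coprime_index_mulG => //; first exact: subsetIl.
  exact: pnat_coprime pix p'P.
have sxGP: x ^: G \subset P.
  apply/subsetP=> _ /imsetP[g Gg ->]; move: Gg; rewrite -defG.
  case/mulsgP=> c h /setIP[_ /cent1P xc] Ph ->.
  by rewrite conjgM (conjgE x) -xc mulKg groupJ // -cycle_subG.
have sO : <<x ^: G>> \subset 'O_p(G).
  apply: pcore_max (class_gen_normal Gx).
  by apply: pgroupS pP; rewrite gen_subG.
exact/(subsetP sO)/mem_gen/class_refl.
Qed.

Lemma normal_subcent (gT : finGroupType) (G N : {group gT}) :
  N <| G -> 'C_G(N) <| G.
Proof.
by move=> nNG; rewrite /normal subsetIl normsI ?normG ?norms_cent ?normal_norm.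
Qed.

(** * The Fitting subgroup of a soluble group *)

Lemma sol_cent_Fitting (gT : finGroupType) (G : {group gT}) :
  solvable G -> 'C_G('F(G)) \subset 'F(G).
Proof.
move=> solG; set C := 'C_G('F(G))%G.
have nCG : C <| G by apply: normal_subcent; apply: Fitting_normal.
have [n Cn1] : exists n, C^`(n) = 1.
  by apply/derivedP; apply: solvableS solG; apply: subsetIl.
have: C^`(n) \subset 'F(G) by rewrite Cn1 sub1G.
(* Climbs the derived series: once a term lies in ['F(G)], so does the preceding one. *)
elim: n {Cn1} => [|n IHn] sCnF; first by rewrite derg0 in sCnF.
apply: IHn; apply: Fitting_max; first exact: gFnormal_trans.
(* The derived subgroup of [C^`(n)] lies in the Fitting subgroup, which it
   centralises: [C^`(n)] has nilpotency class at most 2. *)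
apply/lcnP; exists 2; rewrite lcnSn lcn2; apply/commG1P.
rewrite derg1 -dergSn centsC (subset_trans (der_sub n C)) //.
rewrite (subset_trans (subsetIr _ _)) // centS //.
Qed.

(** For primes [r <> q] the index forces [x] to centralise ['O_r(G)], and ['O_q(G)] is trivial; so
    [x] centralises ['F(G)] and hence lies in it. *)
Lemma mem_pcore_index (gT : finGroupType) (p q : nat) (G : {group gT}) x :
    solvable G -> 'O_q(G) = 1 -> x \in G -> p.-elt x -> q.-nat (cl_index G x) ->
  x \in 'O_p(G).
Proof.
move=> solG Oq1 Gx px qx.
suff Fx: x \in 'F(G).
  rewrite -p_core_Fitting mem_Hall_pcore //.
  exact: nilpotent_pcore_Hall (Fitting_nil G).
apply: (subsetP (sol_cent_Fitting solG)); rewrite inE Gx -sub1set centsC.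
rewrite -(Sylow_gen 'F(G)) gen_subG; apply/bigcupsP=> R /SylowP[r r_pr sylR].
rewrite (nilpotent_Hall_pcore (Fitting_nil G) sylR) p_core_Fitting.
have [-> | neq_rq] := eqVneq r q; first by rewrite Oq1 sub1G.
rewrite centsC sub1set; apply: cent_pcore_index; apply: sub_in_pnat qx => s _ /eqP->.
by rewrite !inE eq_sym.
Qed.

(** * Elements, generation and quotients of Baer factorisations *)

Lemma prime_power_elt (gT : finGroupType) (p : nat) (x : gT) :
  prime p -> p.-elt x -> prime_power #[x].
Proof. by move=> p_pr /p_natP[k ->]; exists p, k. Qed.

Lemma Baer_index (gT : finGroupType) (G A B : {group gT}) (p : nat) x :
    Baer_factorisation G A B -> prime p -> x \in A :|: B -> p.-elt x ->
  exists2 q, prime q & q.-nat (cl_index G x).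
Proof.
case=> _ BaerAB p_pr ABx /(prime_power_elt p_pr)/(BaerAB x ABx)[q [k [q_pr ->]]].
by exists q; rewrite // pnatX pnat_id.
Qed.

Lemma Baer_sub (gT : finGroupType) (G A B : {group gT}) :
  Baer_factorisation G A B -> A :|: B \subset G.
Proof. by case=> <- _; rewrite subUset mulG_subl mulG_subr. Qed.

Lemma subG_pelt (gT : finGroupType) (H K : {group gT}) :
    (forall p x, prime p -> x \in H -> p.-elt x -> x \in K) -> H \subset K.
Proof.
move=> sHK; rewrite -(Sylow_gen H) gen_subG.
apply/bigcupsP=> R /SylowP[r r_pr /and3P[sRH rR _]]; apply/subsetP=> x Rx.
exact: sHK r_pr (subsetP sRH x Rx) (mem_p_elt rR Rx).
Qed.

Lemma Baer_gen (gT : finGroupType) (G A B K : {group gT}) :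
    Baer_factorisation G A B ->
    (forall p x, prime p -> x \in A :|: B -> p.-elt x -> x \in K) ->
  G \subset K.
Proof.
case=> <- _ sK; rewrite mul_subG //; apply: subG_pelt => p x p_pr Hx px.
  by apply: sK p_pr _ px; rewrite inE Hx.
by apply: sK p_pr _ px; rewrite inE Hx orbT.
Qed.

(** Any preimage of [y] can be replaced by its [p]-part, since [y] is its own [p]-part. *)
Lemma pelt_quotient_lift (gT : finGroupType) (H N : {group gT}) (p : nat) y :
  H \subset 'N(N) -> p.-elt y -> y \in H / N ->
  exists x, [/\ x \in H, p.-elt x & y = coset N x].
Proof.
move=> nNH py /morphimP[x Nx Hx def_y]; exists x.`_p; split.
- by rewrite groupX.
- exact: p_elt_constt.
by rewrite (morph_constt [morphism of coset N]) //= -def_y constt_p_elt.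
Qed.

Lemma Baer_quotient_lift (gT : finGroupType) (G A B N : {group gT}) (p : nat) y :
    N <| G -> Baer_factorisation G A B -> y \in A / N :|: B / N -> p.-elt y ->
  exists x, [/\ x \in A :|: B, p.-elt x & y = coset N x].
Proof.
move=> /andP[_ nNG] /Baer_sub; rewrite subUset => /andP[sAG sBG] /setUP[] Hy py.
  have [x [Ax px ->]] := pelt_quotient_lift (subset_trans sAG nNG) py Hy.
  by exists x; rewrite inE Ax.
have [x [Bx px ->]] := pelt_quotient_lift (subset_trans sBG nNG) py Hy.
by exists x; rewrite inE Bx orbT.
Qed.

Lemma Baer_quotient (gT : finGroupType) (G A B N : {group gT}) :
    N <| G -> Baer_factorisation G A B ->
  Baer_factorisation (G / N)%G (A / N)%G (B / N)%G.
Proof.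
move=> nNG Baer; have [defG _] := Baer.
have sAG : A \subset G by rewrite -defG mulG_subl.
split=> [|y ABy [p [k [p_pr oy]]]].
  by rewrite /= -quotientMl ?defG // (subset_trans sAG) ?normal_norm.
have py: p.-elt y by rewrite /p_elt oy pnatX pnat_id.
have [x [ABx px ->]] := Baer_quotient_lift nNG Baer ABy py.
have [q q_pr /(cl_index_pnat_quotient nNG)/p_natP[m ->]] :=
  Baer_index Baer p_pr ABx px.
by exists q, m.
Qed.

Lemma Baer_Cauchy (gT : finGroupType) (G A B : {group gT}) (p : nat) :
    Baer_factorisation G A B -> prime p -> p %| #|G| ->
  exists2 x, x \in A :|: B & #[x] = p.
Proof.
case=> defG _ p_pr pG; have: p %| #|A| * #|B|.
  by rewrite mul_cardG defG dvdn_mulr.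
by rewrite Euclid_dvdM // => /orP[] /(Cauchy p_pr)[x Hx ox];
  exists x; rewrite // inE Hx ?orbT.
Qed.

(** * Solubility *)

Lemma cent_class_coprime_index (gT : finGroupType) (r : nat) (G : {group gT}) x y :
    y \in G -> r.-elt y -> r^'.-nat (cl_index G x) ->
    coprime (cl_index G x) (cl_index G y) ->
  x \in 'C(<<y ^: G>>).
Proof.
move=> Gy ry r'x coxy.
have [R sylR] := Sylow_exists r 'C_G[x].
have sCG : 'C_G[x] \subset G := subsetIl _ _.
have sylRG := pHall_index_trans sCG r'x sylR.
have [|g Gg sCyg] := Sylow_Jsub (Q := <[y]>) sylRG _ ry; first by rewrite cycle_subG.
have Cyg: y ^ g \in 'C_G[x].
  by apply: subsetP (pHall_sub sylR) _ (subsetP sCyg _ _); rewrite memJ_conjg cycle_id.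
have defG : 'C_G[y] * 'C_G[x] = G.
  by apply: coprime_index_mulG; rewrite ?subsetIl // coprime_sym.
rewrite cent_gen -sub_cent1; apply/subsetP=> _ /imsetP[h Gh ->].
(* Here [g = c * d] with [c] centralising [y] and [d] centralising [x], so [y ^ g = y ^ d] and [y]
   itself commutes with [x]. The same splitting of [h] then handles the whole class. *)
have Cy: y \in 'C[x].
  have: g \in 'C_G[y] * 'C_G[x] by rewrite defG.
  case/mulsgP=> c d /setIP[_ /cent1P yc] /setIP[_ Cd] def_g.
  have /setIP[_] := Cyg; rewrite def_g.
  by rewrite conjgM (conjgE y) -yc mulKg groupJr.
have: h \in 'C_G[y] * 'C_G[x] by rewrite defG.
case/mulsgP=> c d /setIP[_ /cent1P yc] /setIP[_ Cd] ->.
by rewrite conjgM (conjgE y) -yc mulKg groupJ.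
Qed.

Lemma Baer_solvable (gT : finGroupType) (G A B : {group gT}) :
  Baer_factorisation G A B -> solvable G.
Proof.
have [m] := ubnP #|G|; elim: m => // m IHm in gT G A B * => leGm Baer.
apply/negPn/negP => nsolG; have sABG := subsetP (Baer_sub Baer).
have solq (N : {group gT}) : N <| G -> N :!=: 1 -> solvable (G / N).
  move=> nNG ntN; apply: (IHm _ (G / N)%G) (Baer_quotient nNG Baer).
  exact: leq_trans (ltn_quotient ntN (normal_sub nNG)) _.
have sol1 (N : {group gT}) : N <| G -> solvable N -> N :=: 1.
  move=> nNG solN; apply/eqP/idPn=> ntN.
  by rewrite (series_sol nNG) solN solq in nsolG.
have nocent x y : x \in G -> y \in G -> x != 1 -> y != 1 ->
    x \in 'C(<<y ^: G>>) -> False.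
  move=> Gx Gy ntx nty Cx; pose Y := <<y ^: G>>%G.
  have nYG : Y <| G := class_gen_normal Gy.
  have ntY : Y :!=: 1.
    apply: contraNneq nty => Y1; rewrite -in_set1 -[[set 1]]Y1.
    exact/mem_gen/class_refl.
  have nCG := normal_subcent nYG.
  have ntC : 'C_G(Y) != 1.
    by apply: contraNneq ntx => C1; rewrite -in_set1 -[[set 1]]C1 inE Gx.
  case/eqP: ntY; apply: sol1 => //.
  (* [Y] is soluble: its part in ['C_G(Y)] is abelian and the rest embeds in the soluble group
     [G / 'C_G(Y)]. *)
  have nCY : Y :&: 'C_G(Y) <| Y.
    exact: normalGI (normal_sub nYG) nCG.
  rewrite (series_sol nCY); apply/andP; split.
    apply: abelian_sol; apply: (subset_trans (subsetIr _ _)).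
    by rewrite (subset_trans (subsetIr _ _)) // centS ?subsetIl.
  have nYC : Y \subset 'N('C_G(Y)).
    by rewrite (subset_trans (normal_sub nYG)) ?normal_norm.
  rewrite /= setIC (isog_sol (second_isog nYC)).
  exact: solvableS (quotientS _ (normal_sub nYG)) (solq _ nCG ntC).
have index_q p x : prime p -> x \in A :|: B -> p.-elt x -> x != 1 ->
    exists q, [/\ prime q, q.-nat (cl_index G x), q != p & q %| #|G|].
  move=> p_pr ABx px ntx; have Gx := sABG x ABx.
  (* The case [q = p] would put [x] in ['O_p(G)], and index 1 would put it in the centre; both are
     trivial. *)
  have [q q_pr qx] := Baer_index Baer p_pr ABx px; exists q; split=> //.
    apply: contraNneq ntx => eq_qp; rewrite eq_qp in qx.
    rewrite -in_set1 -[[set 1]](sol1 'O_p(G)%G) ?pcore_normal //.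
      exact: Wielandt_pcore.
    exact: pgroup_sol (pcore_pgroup p G).
  have [[|k] ix] := p_natP qx; last first.
    by apply: dvdn_trans (dvdn_indexg G 'C_G[x]); rewrite [#|_ : _|]ix dvdn_exp.
  case/negP: ntx; rewrite -in_set1 -[[set 1]](sol1 'Z(G)%G) ?center_normal //.
    rewrite inE Gx /= -sub_cent1.
    move/eqP: ix; rewrite expn0 /cl_index indexg_eq1 subsetI => /andP[_].
    by rewrite sub_cent1.
  exact/abelian_sol/center_abelian.
have conflict (p q r s : nat) x y :
  [/\ x \in A :|: B, p.-elt x, x != 1 & q.-nat (cl_index G x)] ->
  [/\ y \in A :|: B, r.-elt y, y != 1 & s.-nat (cl_index G y)] ->
  q != s -> r != q -> False.
  case=> ABx px ntx qx [ABy ry nty sy] neq_qs neq_rq.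
  apply: (nocent x y) => //; try exact: sABG.
  apply: (@cent_class_coprime_index _ r); rewrite ?sABG //.
    by apply: sub_in_pnat qx => t _ /eqP->; rewrite !inE eq_sym.
  apply: pnat_coprime qx _.
  by apply: sub_in_pnat sy => t _ /eqP->; rewrite !inE eq_sym.
have pick_elt p : prime p -> p %| #|G| -> exists (x : gT) (q : nat),
    [/\ x \in A :|: B, p.-elt x, x != 1 & q.-nat (cl_index G x)] /\
    [/\ prime q, q != p & q %| #|G|].
  move=> p_pr pG; have [x ABx ox] := Baer_Cauchy Baer p_pr pG.
  have px : p.-elt x by rewrite /p_elt ox pnat_id.
  have ntx : x != 1 by rewrite -order_eq1 ox neq_ltn prime_gt1 ?orbT.
  have [q [q_pr qx neq_qp qG]] := index_q p x p_pr ABx px ntx.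
  by exists x, q.
have ntG : 1 < #|G|.
  by rewrite ltnNge -trivg_card_le1; apply: contra nsolG => /eqP->; apply: solvable1.
have p_pr := pdiv_prime ntG; set p := pdiv _ in p_pr.
have [x [q [Hx [q_pr neq_qp qG]]]] := pick_elt p p_pr (pdiv_dvd _).
have [y [s [Hy [s_pr neq_sq sG]]]] := pick_elt q q_pr qG.
(* [x] is (p, q) and [y] is (q, s): they conflict unless [s = p]. *)
have [eq_sp | neq_sp] := eqVneq s p; last first.
  by apply: (conflict _ _ _ _ _ _ Hy Hx); rewrite // eq_sym.
(* Burnside's theorem yields a third prime [r]. An element [z] of type (r, t) conflicts with [x]
   unless [t = q], and in that case with [y]. *)
have /allPn[r] : ~~ all [in [:: p; q]] (primes #|G|).
  apply: contra nsolG => /allP spq; apply: Burnside_p_a_q_b.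
  exact: uniq_leq_size (primes_uniq _) spq.
rewrite mem_primes !inE negb_or => /and3P[r_pr _ rG] /andP[neq_rp neq_rq].
have [z [t [Hz [t_pr neq_tr tG]]]] := pick_elt r r_pr rG.
rewrite eq_sp in Hy.
have [eq_tq | neq_tq] := eqVneq t q; last first.
  by apply: (conflict _ _ _ _ _ _ Hx Hz); rewrite // eq_sym.
by apply: (conflict _ _ _ _ _ _ Hy Hz); rewrite // eq_tq eq_sym.
Qed.

(** * Normal Hall subgroups when the [q]-core is trivial *)

(** By Cauchy in [G / M], a prime [r] outside [pi] dividing the index gives an element of order [r]
    in the image of [A] or [B]; but it lifts to an [r]-element of [A :|: B], which lies in [M]. *)
Lemma Baer_pnat_index (gT : finGroupType) (pi : nat_pred)
    (G A B M : {group gT}) :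
    Baer_factorisation G A B -> M <| G ->
    (forall r x, prime r -> r \notin pi -> x \in A :|: B -> r.-elt x -> x \in M) ->
  pi.-nat #|G : M|.
Proof.
move=> Baer nMG sM; apply/pnatP=> // r r_pr rGM; apply: contraT => pi'r.
have [|y ABy oy] := Baer_Cauchy (Baer_quotient nMG Baer) r_pr.
  by rewrite card_quotient ?normal_norm.
have ry : r.-elt y by rewrite /p_elt oy pnat_id.
have [x [ABx rx def_y]] := Baer_quotient_lift nMG Baer ABy ry.
by have:= prime_gt1 r_pr; rewrite -oy def_y coset_id ?order1 ?(sM r).
Qed.

(** If [x] has [s]-power index, dividing out [N = 'O_s(G)] makes the [s]-core trivial and so puts
    the image of [x] in the [r]-core. As [N] is a [q']-group, even for [s = q], this lifts to
    [G]. *)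
Lemma Baer_mem_pcore_compl (gT : finGroupType) (q r : nat)
    (G A B : {group gT}) x :
    Baer_factorisation G A B -> 'O_q(G) = 1 -> prime r -> r != q ->
    x \in A :|: B -> r.-elt x ->
  x \in 'O_q^'(G).
Proof.
move=> Baer Oq1 r_pr neq_rq ABx rx.
have Gx := subsetP (Baer_sub Baer) x ABx.
have [s s_pr sx] := Baer_index Baer r_pr ABx rx.
pose N := 'O_s(G)%G; have nNG : N <| G := pcore_normal _ _.
have Nx : x \in 'N(N) := subsetP (normal_norm nNG) x Gx.
have q'N : q^'.-group N.
  have [eq_sq | neq_sq] := eqVneq s q; first by rewrite /N eq_sq /= Oq1 pgroup1.
  by apply: pi_pgroup (pcore_pgroup _ _) _; rewrite !inE.
have : coset N x \in 'O_q^'(G / N).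
  have: coset N x \in 'O_r(G / N).
    apply: (mem_pcore_index (q := s)).
    - exact/quotient_sol/(Baer_solvable Baer).
    - exact: trivg_pcore_quotient.
    - exact: mem_quotient.
    - exact: morph_p_elt.
    exact: cl_index_pnat_quotient.
  by apply: subsetP; apply: sub_pcore => t /eqnP->; rewrite !inE.
rewrite (pquotient_pcore nNG q'N) => xN.
have nNO : N <| 'O_q^'(G).
  by rewrite /normal pcore_max //= (subset_trans (pcore_sub _ _)) ?gFnorm.
by rewrite -(quotientGK nNO) inE Nx inE.
Qed.

Lemma Baer_pcore_compl_Hall (gT : finGroupType) (q : nat) (G A B : {group gT}) :
  Baer_factorisation G A B -> 'O_q(G) = 1 -> q^'.-Hall(G) 'O_q^'(G).
Proof.
move=> Baer Oq1; rewrite /pHall pcore_sub pcore_pgroup pnatNK.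
apply: (Baer_pnat_index Baer (pcore_normal _ _)) => r x r_pr neq_rq ABx rx.
exact: Baer_mem_pcore_compl Baer Oq1 r_pr neq_rq ABx rx.
Qed.

(** * Sylow subgroups of a product *)

(** Conjugating by elements of [A] and of [B] brings Sylow subgroups of both into one Sylow subgroup
    of [G]. Their product fills it by comparing [p]-parts in [#|A| * #|B| = #|G| * #|A :&: B|]. *)
Lemma mulG_Sylow (gT : finGroupType) (p : nat) (G A B : {group gT}) :
    A * B = G ->
  exists P Q R : {group gT},
    [/\ p.-Sylow(G) P, p.-Sylow(A) Q, p.-Sylow(B) R & Q * R = P].
Proof.
move=> defG; have sAG : A \subset G by rewrite -defG mulG_subl.
have sBG : B \subset G by rewrite -defG mulG_subr.
have [Q sylQ] := Sylow_exists p A; have [R sylR] := Sylow_exists p B.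
have [P sylP sQP] := Sylow_superset (subset_trans (pHall_sub sylQ) sAG) (pHall_pgroup sylQ).
have [g Gg sRPg] := Sylow_subJ sylP (subset_trans (pHall_sub sylR) sBG) (pHall_pgroup sylR).
move: Gg sRPg; rewrite -{1}defG => /mulsgP[a b Aa Bb ->]; rewrite conjsgM -sub_conjgV => sRP.
exists (P :^ a)%G, (Q :^ a)%G, (R :^ b^-1)%G; split.
- by rewrite pHallJ ?(subsetP sAG).
- by rewrite pHallJ.
- by rewrite pHallJ ?groupV.
apply/eqP; rewrite eqEcard mul_subG ?conjSg //=.
have sylQa : p.-Sylow(A) (Q :^ a)%G by rewrite pHallJ.
have sylRb : p.-Sylow(B) (R :^ b^-1)%G by rewrite pHallJ ?groupV.
have sylPa : p.-Sylow(G) (P :^ a)%G by rewrite pHallJ ?(subsetP sAG).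
have := congr1 (fun n => n`_p)%N (mul_cardG A B).
rewrite /= defG !partnM ?cardG_gt0 // -(card_Hall sylQa) -(card_Hall sylRb).
rewrite -(card_Hall sylPa) mul_cardG => eqPQR.
have le_QR : #|Q :^ a :&: R :^ b^-1| <= #|A :&: B|`_p.
  apply: dvdn_leq (part_gt0 _ _) _.
  rewrite -(part_pnat_id (pgroupS (subsetIl _ _) (pHall_pgroup sylQa))).
  apply/partn_dvd/cardSg => //.
  by apply: setISS; [exact: pHall_sub sylQa | exact: pHall_sub sylRb].
by rewrite -(leq_pmul2r (part_gt0 p #|A :&: B|)) -eqPQR leq_mul2l le_QR orbT.
Qed.

(** * The quotient by the centraliser of the [p]-core *)

Lemma Baer_pcore_compl_central (gT : finGroupType) (p : nat)
    (G A B : {group gT}) :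
    Baer_factorisation G A B -> prime p ->
    (forall r x, prime r -> x \in A :|: B -> r.-elt x ->
       p.-nat (cl_index G x)) ->
  [/\ p.-Sylow(G) 'O_p(G), p^'.-Hall(G) 'O_p^'(G) & G \subset 'C('O_p^'(G))].
Proof.
move=> Baer p_pr pAB; have [defG _] := Baer; have solG := Baer_solvable Baer.
have sABG := subsetP (Baer_sub Baer).
have sylO : p.-Sylow(G) 'O_p(G).
  rewrite /pHall pcore_sub pcore_pgroup.
  apply: (Baer_pnat_index Baer (pcore_normal _ _)) => r x r_pr.
  rewrite inE /= negbK => /eqP-> ABx px.
  exact: Wielandt_pcore (sABG x ABx) px (pAB p x p_pr ABx px).
have [H hallH] := Hall_exists p^' solG.
have defHO : H * 'O_p(G) = G.
  have [sHG p'H pH] := and3P hallH; have [sOG pO p'O] := and3P sylO.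
  by apply: coprime_index_mulG sHG sOG (pnat_coprime _ p'O); rewrite -(pnatNK p).
have cHO : 'O_p(G) \subset 'C(H).
  have [P [Q [R [sylP sylQ sylR defP]]]] := mulG_Sylow p defG.
  have eqPO : P :=: 'O_p(G) by apply: (eq_Hall_pcore sylO).
  (* Otherwise the centraliser of [H] in ['O_p(G)] lies in a maximal subgroup [M], which will be
     shown to contain both factors of ['O_p(G) = Q * R]. *)
  have [eqO | [M maxM sCM]] := maximal_exists (subsetIl 'O_p(G) 'C(H)).
    by rewrite -eqO subsetIr.
  have nMO := p_maximal_normal (pcore_pgroup p G) maxM.
  (* [x] centralises a Hall subgroup [H :^ u] with [u] in ['O_p(G)], so it is
     an ['O_p(G)]-conjugate of an element of ['C(H)]. *)
  have sM x : x \in A :|: B -> p.-elt x -> x \in 'O_p(G) -> x \in M.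
    move=> ABx px Ox; have px' := pAB p x p_pr ABx px; rewrite -(pnatNK p) in px'.
    have sCG : 'C_G[x] \subset G := subsetIl _ _.
    have [K hallK] := Hall_exists p^' (solvableS sCG solG).
    have [g] := Hall_trans solG (pHall_index_trans sCG px' hallK) hallH.
    rewrite -{1}defHO => /mulsgP[h u Hh Ou ->] defK.
    have: x \in 'C(H :^ u).
      rewrite -(conjGid Hh) -conjsgM -defK -sub_cent1.
      exact: subset_trans (pHall_sub hallK) (subsetIr _ _).
    rewrite centJ mem_conjg => CHx; have Ou' := groupVr Ou.
    rewrite -(memJ_norm _ (subsetP (normal_norm nMO) _ Ou')).
    by rewrite (subsetP sCM) // inE CHx groupJ.
  case/maxgroupp/andP: maxM => _ /negP[]; rewrite /= -{1}eqPO -defP.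
  have sQRO: Q * R \subset 'O_p(G) by rewrite defP eqPO.
  rewrite mul_subG //; apply/subsetP=> x Hx; apply: sM.
  - by rewrite inE (subsetP (pHall_sub sylQ)).
  - exact: mem_p_elt (pHall_pgroup sylQ) Hx.
  - exact: subsetP (subset_trans (mulG_subl _ _) sQRO) x Hx.
  - by rewrite inE (subsetP (pHall_sub sylR)) ?orbT.
  - exact: mem_p_elt (pHall_pgroup sylR) Hx.
  exact: subsetP (subset_trans (mulG_subr _ _) sQRO) x Hx.
have nHG : H <| G.
  by rewrite /normal (pHall_sub hallH) -{1}defHO mul_subG ?normG ?cents_norm.
have defH := normal_Hall_pcore hallH nHG.
split=> //; first by rewrite defH.
apply: (Baer_gen Baer) => r x r_pr ABx rx.
by apply: cent_pcore_index; rewrite pnatNK; apply: (pAB r).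
Qed.

Lemma Baer_quotient_cent_pcore (gT : finGroupType) (p : nat)
    (G A B : {group gT}) (Q := (G / 'C_G('O_p(G)))%G) :
    Baer_factorisation G A B -> prime p ->
  [/\ p.-Sylow(Q) 'O_p(Q), p^'.-Hall(Q) 'O_p^'(Q) & Q \subset 'C('O_p^'(Q))].
Proof.
move=> Baer p_pr; have sABG := subsetP (Baer_sub Baer).
have nCG := normal_subcent (pcore_normal p G).
apply: (Baer_pcore_compl_central (Baer_quotient nCG Baer) p_pr) => r y r_pr ABy ry.
have [x [ABx rx ->]] := Baer_quotient_lift nCG Baer ABy ry.
have [s s_pr sx] := Baer_index Baer r_pr ABx rx.
have [eq_sp | neq_sp] := eqVneq s p.
  by rewrite eq_sp in sx; apply: cl_index_pnat_quotient.
rewrite coset_id; first by rewrite /cl_index index_cent1 class1G cards1.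
rewrite inE sABG //; apply: cent_pcore_index.
by apply: sub_in_pnat sx => t _ /eqP->; rewrite !inE.
Qed.

(** * Centralisers of sets of [p]-elements of [q]-power index *)

Lemma Baer_cent_pnat_index (gT : finGroupType) (p q : nat)
    (G A B : {group gT}) (S : {set gT}) :
    Baer_factorisation G A B -> prime p -> S \subset G -> p.-group <<S>> ->
    {in S, forall x, q.-nat (cl_index G x)} ->
  q.-nat #|G : 'C_G(S)|.
Proof.
move=> Baer p_pr sSG pS qS; have solG := Baer_solvable Baer.
have [eq_qp | neq_qp] := eqVneq q p.
  rewrite {q}eq_qp in qS *.
  have nCG := normal_subcent (pcore_normal p G).
  have [_ hallK _] := Baer_quotient_cent_pcore Baer p_pr.
  set Q := (G / _)%G in hallK.
  (* The preimage [K] of ['O_p^'(Q)] has [p]-power index; it remains to see that it centralises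
     [S]. *)
  have [K defK sCK sKG] := inv_quotientS nCG (pcore_sub p^' Q).
  have pK : p.-nat #|G : K|.
    rewrite -(index_quotient_eq (H := 'C_G('O_p(G)))) ?normal_norm //; last first.
      by rewrite (subset_trans (subsetIr _ _)).
    by rewrite -defK -(pnatNK p); case/and3P: hallK.
  apply: pnat_dvd pK; apply: indexgS; rewrite subsetI sKG.
  rewrite centsC; apply/subsetP=> x Sx; rewrite -sub_cent1.
  have px := mem_p_elt pS (mem_gen Sx); have Gx := subsetP sSG x Sx.
  have Ox := Wielandt_pcore Gx px (qS x Sx).
  have nCK := subset_trans sKG (normal_norm nCG).
  have sCx : 'C_G('O_p(G)) \subset 'C_G[x] by rewrite setIS // -cent_set1 centS ?sub1set.
  (* The inclusion of [K] in ['C_G[x]] can be checked in [Q], where the image of ['C_G[x]] has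
     [p]-power index and so contains the [p']-core. *)
  apply: subset_trans (subsetIr G _); rewrite -(quotientSGK nCK sCx) -defK.
  apply: pcore_sub_index; first by rewrite quotientS ?subsetIl.
  rewrite pnatNK; apply: pnat_dvd (qS x Sx); apply: index_quotient.
  by rewrite (subset_trans (subsetIl _ _)) ?normal_norm.
pose N := 'O_q(G)%G; have nNG : N <| G := pcore_normal _ _.
have sSGg : <<S>> \subset G by rewrite gen_subG.
have q'S : q^'.-group <<S>>.
  by apply: pi_pgroup pS _; rewrite !inE eq_sym.
(* [H] will centralise [S]: [[~: H, <<S>>]] lies in [H], and also in [N] because the image of [H] is
   the [q']-core of [G / N], which the image of [S] centralises. *)
have [H hallH sSH] := Hall_superset solG sSGg q'S.
have hallO : q^'.-Hall(G / N) 'O_q^'(G / N).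
  exact: Baer_pcore_compl_Hall (Baer_quotient nNG Baer) (trivg_pcore_quotient _ _).
have [nNH nNS] : H \subset 'N(N) /\ <<S>> \subset 'N(N).
  by split; apply: subset_trans (normal_norm nNG); rewrite ?(pHall_sub hallH).
have defHN := eq_Hall_pcore hallO (quotient_pHall nNH hallH).
have sHSN : [~: H, <<S>>] \subset N.
  rewrite -quotient_cents2 // defHN quotient_gen ?cent_gen; last first.
    by rewrite -gen_subG.
  rewrite centsC; apply/subsetP=> _ /morphimP[x Nx Sx ->].
  by apply: cent_pcore_index; rewrite pnatNK; apply/cl_index_pnat_quotient/qS.
have cHS : H \subset 'C(S).
  rewrite -cent_gen; apply/commG1P/trivgP.
  have <- : N :&: H = 1.
    apply: coprime_TIg.
    exact: pnat_coprime (pcore_pgroup q G) (pHall_pgroup hallH).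
  by rewrite subsetI sHSN commg_subl normsG.
have [sHG _ qH] := and3P hallH; rewrite pnatNK in qH.
by apply: pnat_dvd qH; apply: indexgS; rewrite subsetI sHG.
Qed.

Lemma coprime_indexI (gT : finGroupType) (G H K : {group gT}) :
    H \subset G -> K \subset G -> coprime #|G : H| #|G : K| ->
  #|G : H :&: K| = (#|G : H| * #|G : K|)%N.
Proof.
move=> sHG sKG coHK.
rewrite -(Lagrange_index sHG (subsetIl H K)) indexgI; congr (_ * _)%N.
by rewrite -(indexMg K H) (coprime_index_mulG sKG sHG) // coprime_sym.
Qed.

(** * One prime for each Sylow subgroup of a factor, two for one of [G] *)

(** Take [x] noncentral of [q]-power index and [y] of [r]-power index, [r <> q]; then [x * y] is in
    [T], of [s]-power index. If [s = r], the index of [x] would be 1. If [s] is neither, the index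
    of [x * y] is 1, since it divides the product of the other two. Otherwise [s = q]; in both
    remaining cases [y = x^-1 * (x * y)] has [q]-power index. *)
Lemma Baer_uniform_index (gT : finGroupType) (p : nat)
    (G A B T : {group gT}) :
    Baer_factorisation G A B -> prime p -> T \subset A :|: B -> p.-group T ->
  exists2 q, prime q & {in T, forall x, q.-nat (cl_index G x)}.
Proof.
move=> Baer p_pr sTAB pT; have sTG := subset_trans sTAB (Baer_sub Baer).
have idxT x : x \in T -> exists2 q, prime q & q.-nat (cl_index G x).
  by move=> Tx; apply: (Baer_index Baer p_pr (subsetP sTAB x Tx) (mem_p_elt pT Tx)).
have idx2 (q : nat) x y z : x \in T -> y \in T -> 'C_G([set x; y]) \subset 'C_G[z] ->
    q.-nat (cl_index G x) -> q.-nat (cl_index G y) -> q.-nat (cl_index G z).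
  move=> Tx Ty sCz qx qy; apply: pnat_dvd (indexgS G sCz) _.
  have sST : [set x; y] \subset T by apply/subsetP=> t /set2P[] ->.
  apply: (Baer_cent_pnat_index Baer p_pr); first exact: subset_trans sST sTG.
    by apply: pgroupS pT; rewrite gen_subG.
  by move=> t /set2P[] ->.
have [/forall_inP T1 | ] := boolP [forall (x | x \in T), cl_index G x == 1%N].
  (* All elements of [T] are central, so any prime would do. *)
  by exists p => // x Tx; rewrite (eqP (T1 x Tx)).
rewrite negb_forall_in => /exists_inP[x Tx ntx].
have [q q_pr qx] := idxT x Tx; exists q => // y Ty.
have [r r_pr ry] := idxT y Ty; have Txy := groupM Tx Ty.
have [s s_pr sxy] := idxT (x * y) Txy.
have cent2 u v g : g \in 'C_G([set u; v]) -> [/\ g \in G, commute g u & commute g v].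
  case/setIP=> Gg /centP cg; split=> //; apply: cg; rewrite !inE eqxx ?orbT //.
have idx_y: q.-nat (cl_index G (x * y)) -> q.-nat (cl_index G y).
  apply: idx2 qx => //; apply/subsetP=> g /cent2[Gg gx gxy].
  by rewrite inE Gg; apply/cent1P; rewrite -[y](mulKg x); apply/commuteM/gxy/commuteV.
have idx_x: r.-nat (cl_index G (x * y)) -> r.-nat (cl_index G x).
  apply: idx2 ry => //; apply/subsetP=> g /cent2[Gg gy gxy].
  by rewrite inE Gg; apply/cent1P; rewrite -[x](mulgK y); apply/(commuteM gxy)/commuteV.
have [<- // | neq_rq] := eqVneq r q.
have [eq_sq | neq_sq] := eqVneq s q; first by rewrite eq_sq in sxy; apply: idx_y.
have [eq_sr | neq_sr] := eqVneq s r.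
  rewrite eq_sr in sxy; case/eqP: ntx; apply: pnat_1 qx _.
  by apply: sub_in_pnat (idx_x sxy) => t _ /eqP->; rewrite !inE.
apply: idx_y; rewrite (@pnat_1 s (cl_index G (x * y))) //.
have co_xy : coprime #|G : 'C_G[x]| #|G : 'C_G[y]|.
  apply: pnat_coprime qx _.
  by apply: sub_in_pnat ry => t _ /eqP->; rewrite !inE.
have sCxy : 'C_G[x] :&: 'C_G[y] \subset 'C_G[x * y].
  apply/subsetP=> g /setIP[/setIP[Gg /cent1P gx] /setIP[_ /cent1P gy]].
  by rewrite inE Gg; apply/cent1P/commuteM.
apply: pnat_dvd (indexgS G sCxy) _; rewrite coprime_indexI ?subsetIl // pnatM.
apply/andP; split; first apply: sub_in_pnat qx => t _ /eqP->.
  by rewrite !inE eq_sym.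
by apply: sub_in_pnat ry => t _ /eqP->; rewrite !inE eq_sym.
Qed.

Lemma Baer_Sylow_cent_index (gT : finGroupType) (p : nat)
    (G A B P : {group gT}) :
    Baer_factorisation G A B -> prime p -> p.-Sylow(G) P ->
  exists q r : nat, [/\ prime q, prime r & (pred2 q r).-nat #|G : 'C_G(P)|].
Proof.
move=> Baer p_pr sylP; have [defG _] := Baer; have sABG := Baer_sub Baer.
have [P0 [Q [R [sylP0 sylQ sylR defP0]]]] := mulG_Sylow p defG.
have [g Gg ->] := Sylow_trans sylP0 sylP.
have -> : #|G : 'C_G(P0 :^ g)| = #|G : 'C_G(P0)|.
  by rewrite -[RHS](indexJg _ _ g) conjIg -centJ (conjGid Gg).
have sQAB : Q \subset A :|: B by apply/subsetU; rewrite (pHall_sub sylQ).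
have sRAB : R \subset A :|: B by apply/subsetU; rewrite (pHall_sub sylR) orbT.
have [q q_pr qQ] := Baer_uniform_index Baer p_pr sQAB (pHall_pgroup sylQ).
have [r r_pr rR] := Baer_uniform_index Baer p_pr sRAB (pHall_pgroup sylR).
have sQRG : Q :|: R \subset G by rewrite (subset_trans _ sABG) // subUset sQAB.
have genQR : <<Q :|: R>> = P0.
  by rewrite -[RHS]genGid -defP0 genM_join.
exists q, r; split=> //.
(* Equal primes: [Q :|: R] is treated as one set. Distinct primes: the coprime indices multiply. *)
have [eq_rq | neq_rq] := eqVneq r q.
  rewrite eq_rq in rR; rewrite -genQR cent_gen.
  apply: (@sub_in_pnat q) => [t _ /eqP->|]; first by rewrite !inE eqxx.
  apply: (Baer_cent_pnat_index Baer p_pr) => //.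
    by rewrite genQR (pHall_pgroup sylP0).
  by move=> x /setUP[/qQ | /rR].
have [sQG sRG] : Q \subset G /\ R \subset G by apply/andP; rewrite -subUset.
have qCQ : q.-nat #|G : 'C_G(Q)|.
  by apply: (Baer_cent_pnat_index Baer p_pr); rewrite ?genGid ?(pHall_pgroup sylQ).
have rCR : r.-nat #|G : 'C_G(R)|.
  by apply: (Baer_cent_pnat_index Baer p_pr); rewrite ?genGid ?(pHall_pgroup sylR).
have -> : 'C_G(P0) = 'C_G(Q) :&: 'C_G(R).
  by rewrite -genQR cent_gen centU -setIIr.
rewrite coprime_indexI ?subsetIl //; last first.
  apply: pnat_coprime qCQ _.
  by apply: sub_in_pnat rCR => t _ /eqP->; rewrite !inE.
rewrite pnatM; apply/andP; split.
  by apply: sub_in_pnat qCQ => t _ /eqP->; rewrite !inE eqxx.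
by apply: sub_in_pnat rCR => t _ /eqP->; rewrite !inE eqxx orbT.
Qed.

Theorem theorem5 (gT : finGroupType) (G A B P : {group gT}) (p : nat) :
  Baer_factorisation G A B -> prime p -> p.-Sylow(G) P ->
  [/\ ~~ abelian P ->
        exists q : nat, prime q /\ (pred2 p q).-nat #|G : 'C_G(P)|,
      abelian P ->
        exists q r : nat,
          [/\ prime q, prime r, q != p, r != p
            & (pred2 q r).-nat #|G : 'C_G(P)|]
    & let Q := (G / 'C_G('O_p(G)))%G in
      [/\ p_decomposable p Q, abelian 'O_p^'(Q)
        & (size (primes #|'O_p^'(Q)|) <= 2)%N]].
Proof.
move=> Baer p_pr sylP; have [sPG pP p'P] := and3P sylP.
have [q [r [q_pr r_pr qrP]]] := Baer_Sylow_cent_index Baer p_pr sylP.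
split=> [ncPP | cPP | Q].
- have [eq_qp | neq_qp] := eqVneq q p; first by exists r; rewrite -eq_qp.
  have [eq_rp | neq_rp] := eqVneq r p.
    exists q; split=> //; rewrite -eq_rp.
    by apply: sub_in_pnat qrP => t _; rewrite !inE orbC.
  (* With both primes different from [p], the index is prime to [p], so the [p]-group [P], which
     normalises ['C_G(P)], lies in it. *)
  case/negP: ncPP; apply: subset_trans (subsetIr G _).
  apply: (pgroup_sub_index (subsetIl G _) sPG _ pP).
    exact/esym/normC/(normsI (subset_trans sPG (normG G)))/norms_cent/normG.
  apply: sub_in_pnat qrP => t _ /pred2P[] ->; rewrite !inE //.
- have p'CP : p^'.-nat #|G : 'C_G(P)|.
    by apply: pnat_dvd p'P; apply: indexgS; rewrite subsetI sPG.
  (* [q] or [r] may be [p], which does not divide the index; [f] replaces it by some other prime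
     [s]. *)
  have [s s_pr neq_sp] : exists2 s, prime s & s != p.
    by have [-> | neq_p2] := eqVneq p 2; [exists 3 | exists 2; rewrite // eq_sym].
  pose f t := if t == p then s else t.
  have Pf t : prime t -> prime (f t) /\ f t != p.
    by rewrite /f; case: (eqVneq t p).
  have [[fq_pr fq_p] [fr_pr fr_p]] := (Pf q q_pr, Pf r r_pr).
  exists (f q), (f r); split=> //.
  have: [predI pred2 q r & p^'].-nat #|G : 'C_G(P)| by rewrite pnatI qrP.
  apply: sub_in_pnat => t _; rewrite !inE /f => /andP[/pred2P[] -> /negPf->].
    by rewrite eqxx.
  by rewrite eqxx orbT.
have [sylO hallO cOQ] := Baer_quotient_cent_pcore Baer p_pr.
have sOQ := pcore_sub p^' Q; split.
- have tiO : 'O_p(Q) :&: 'O_p^'(Q) = 1.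
    apply: coprime_TIg; exact: pnat_coprime (pcore_pgroup p Q) (pcore_pgroup p^' Q).
  rewrite /p_decomposable dprodE //; last first.
    by rewrite centsC (subset_trans (pcore_sub _ _)).
  apply: coprime_index_mulG; rewrite ?pcore_sub //.
  have [[_ pO p'O] [_ p'K pK]] := (and3P sylO, and3P hallO).
  exact: pnat_coprime p'O pK.
- exact: subset_trans sOQ cOQ.
have dvdQ : #|'O_p^'(Q)| %| #|G : 'C_G(P)|.
  apply: dvdn_trans (cardSg sOQ) _; rewrite card_quotient; last first.
    exact/normal_norm/normal_subcent/pcore_normal.
  exact/indexgS/setIS/centS/pcore_sub_Hall.
rewrite -[2]/(size [:: q; r]); apply: uniq_leq_size (primes_uniq _) _ => t.
rewrite mem_primes => /and3P[t_pr _ tO].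
by have:= pnatP _ (indexg_gt0 _ _) qrP t t_pr (dvdn_trans tO dvdQ); rewrite !inE.
Qed.
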